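(* Let $A\in\mathbb{R}^{n\times n}$ be symmetric positive definite, and let $k$ be a fixed integer with $0<k<n$. Let $A_k^*\in\mathbb{R}^{k\times k}$ be a principal submatrix of $A$ that maximizes $\log\mathrm{vol}(B)$ among all principal submatrices $B\in\mathbb{R}^{k\times k}$ of $A$. Then the strong rank-revealing Cholesky selection algorithm with relaxation factor $\eta=1$ is a 1-interchange algorithm for maximizing the log-volume, and its output matrix $A_k\equiv A[\mathcal{S}]$ satisfies $$0\le\log\mathrm{vol}(A_k^* )-\log\mathrm{vol}(A_k)\le\frac{k-1}{2k-1}\log\mathrm{vol}\bigl(A_k^*/\lambda_n(A)\bigr),$$ where $\frac{k-1}{2k-1}<\frac12$.
   Context: $\lambda_1(A)\ge\cdots\ge\lambda_n(A)$ are the eigenvalues of $A$. For $\mathcal{S}\subset\{1,\ldots,n\}$, $A[\mathcal{S}]$ is the principal submatrix of $A$ with rows and columns indexed by $\mathcal{S}$. For a square matrix $B$, $\mathrm{vol}(B)=|\det(B)|$. Strong rank-revealing Cholesky selection. Input: symmetric positive semi-definite $A\in\mathbb{R}^{n\times n}$, integer $0<k\le\mathrm{rank}(A)$, relaxation factor $\eta\ge1$. Start with any $\mathcal{S}\subset\{1,\ldots,n\}$ with $|\mathcal{S}|=k$ and $A[\mathcal{S}]$ nonsingular. As long as there are $i\in\mathcal{S}$ and $j\in\{1,\ldots,n\}-\mathcal{S}$ such that $\mathcal{T}=(\mathcal{S}-\{i\})\cup\{j\}$ satisfies $\mathrm{vol}(A[\mathcal{T}])>\sqrt{\eta}\,\mathrm{vol}(A[\mathcal{S}])$,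 replace $\mathcal{S}$ by such a $\mathcal{T}$. When no such swap exists, output $A[\mathcal{S}]$. 1-interchange algorithm for a set function $f$ on $\{1,\ldots,n\}$: start with a $k$-element set $\mathcal{S}$; while there are $x\in\mathcal{S}$ and $y\notin\mathcal{S}$ with $f((\mathcal{S}-\{x\})\cup\{y\})>f(\mathcal{S})$, replace $\mathcal{S}$ by $(\mathcal{S}-\{x\})\cup\{y\}$; output $\mathcal{S}$ when no such pair exists. Here $f(\mathcal{S})=\log\mathrm{vol}(A[\mathcal{S}])$. *)

(* Defs.v *)
From Stdlib Require Export Relations.
From mathcomp Require Export all_boot all_order all_algebra.
From mathcomp Require Export reals exp.
From mathcomp Require Export polyrcf.

Set Implicit Arguments.
Unset Strict Implicit.
Unset Printing Implicit Defensive.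

Import Order.TTheory GRing.Theory Num.Theory.
Local Open Scope ring_scope.

Section Matrices.
Variable R : realType.

Definition psdmx n (A : 'M[R]_n) : Prop :=
  A^T = A /\ forall x : 'cV[R]_n, 0 <= (x^T *m A *m x) 0 0.

Definition pdmx n (A : 'M[R]_n) : Prop :=
  A^T = A /\ forall x : 'cV[R]_n, x != 0 -> 0 < (x^T *m A *m x) 0 0.

(* The index set is {0, .., n-1}; [enum_val] enumerates S increasingly. *)
Definition prinsub n (A : 'M[R]_n) (S : {set 'I_n}) : 'M[R]_#|S| :=
  mxsub (@enum_val _ (mem S)) (@enum_val _ (mem S)) A.

Definition vol m (B : 'M[R]_m) : R := `|\det B|.

(* [ln 0 = 0], so this is the mathematical log-volume only for nonsingular B. *)
Definition logvol m (B : 'M[R]_m) : R := ln (vol B).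

(* The real roots of the characteristic polynomial, each repeated according to
   its multiplicity, in nonincreasing order ([rootsR] lists every distinct root
   once).  This has length n when A is symmetric. *)
Definition eigenvalues n (A : 'M[R]_n) : seq R :=
  sort >=%R (flatten [seq nseq (mup x (char_poly A)) x
                     | x <- rootsR (char_poly A)]).

(* lambda_i(A), with i counted from 1, so that [eigval A n] is lambda_n(A). *)
Definition eigval n (A : 'M[R]_n) (i : nat) : R := nth 0 (eigenvalues A) i.-1.

End Matrices.

(* A nondeterministic exchange procedure on subsets of {0, .., n-1}: the sets it
   may start from, and the replacements it may perform. *)
Record procedure (n : nat) := Procedure {
  start : {set 'I_n} -> Prop;
  step : relation {set 'I_n} }.

Definition output n (P : procedure n) (S : {set 'I_n}) : Prop :=
  exists S0, [/\ start P S0, clos_refl_trans _ (step P) S0 S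
               & forall T, ~ step P S T].

Definition swap n (S : {set 'I_n}) (i j : 'I_n) : {set 'I_n} :=
  j |: (S :\ i).

Section Algorithms.
Variables (R : realType) (n : nat).

(* The conditions on the input are part of [start]: the procedure can run only
   on an admissible input. *)
Definition srr_cholesky (A : 'M[R]_n) (k : nat) (eta : R) : procedure n :=
  {| start S := [/\ psdmx A, (0 < k <= \rank A)%N, 1 <= eta,
                    #|S| = k & prinsub A S \in unitmx];
     step S T := exists i j, [/\ i \in S, j \notin S, T = swap S i j
                   & vol (prinsub A T) > Num.sqrt eta * vol (prinsub A S)] |}.

Definition interchange1 (f : {set 'I_n} -> R) (k : nat) : procedure n :=
  {| start S := #|S| = k;
     step S T := exists x y, [/\ x \in S, y \notin S, T = swap S x y
                   & f T > f S] |}.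

(* P is a 1-interchange algorithm for f on k-element sets. Sets of another
   size never occur in a run, so the moves are compared on k-element sets. *)
Definition is_interchange1 (P : procedure n) (f : {set 'I_n} -> R) (k : nat) :
    Prop :=
  (forall S : {set 'I_n}, start P S <-> start (interchange1 f k) S) /\
  (forall S T : {set 'I_n}, #|S| = k ->
     (step P S T <-> step (interchange1 f k) S T)).

Definition max_logvol (A : 'M[R]_n) (k : nat) (S : {set 'I_n}) : Prop :=
  #|S| = k /\
  forall T : {set 'I_n}, #|T| = k ->
    logvol (prinsub A T) <= logvol (prinsub A S).

End Algorithms.

(* Main.v *)
Require Import Defs.
From mathcomp Require Import fingroup perm sesquilinear spectral complex ring lra.

Import Order.TTheory GRing.Theory Num.Theory.
Local Open Scope ring_scope.

Set Implicit Arguments.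
Unset Strict Implicit.
Unset Printing Implicit Defensive.

(** A swap-optimal set is compared with the best set through the set function
    g(S) = ln det (A/c)[S], where c is the smallest eigenvalue of A.

    On a k-element set, g is the log-volume up to the constant k ln c; hence
    the swap moves for volume, for log-volume and for g coincide, and
    g(Sopt) is the log-volume on the right-hand side of the bound.  Dividing
    by c makes g increasing; g also has diminishing increments and vanishes
    on the empty set.

    Both properties come from one formula ([schur_minimum]): for j outside S,
    det A[S + j] / det A[S] is the minimum of y^T A y over the vectors y with
    y_j = 1 that vanish outside S + j.  Enlarging S enlarges the feasible set,
    so the ratio decreases: g has diminishing increments.  By the Rayleigh
    bound y^T A y >= c y^T y >= c, the ratio is at least c: g increases.

    For such a g ([swap_optimum_bound]), let S be swap-optimal, i in S, and
    S' = S - i.  Then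
        g(Sopt) <= g(S' + Sopt) <= g(S') + sum_(j in Sopt) (g(S' + j) - g(S')),
    and each of the k terms is at most g(S) - g(S'), because no swap improves
    on S.  So g(Sopt) <= g(S) + (k - 1) (g(S) - g(S - i)).  Summing over i and
    using sum_(i in S) (g(S) - g(S - i)) <= g(S) gives
        k g(Sopt) <= (2 k - 1) g(S),
    which is the stated inequality after rearrangement.

    The spectral theorem enters through [eigval_min_pd]: the real roots of the
    characteristic polynomial are n in number with multiplicity, the smallest
    is positive, and it satisfies the Rayleigh bound. *)

(** * Swap optima of increasing set functions with diminishing increments *)

Lemma finset_ind (T : finType) (P : {set T} -> Prop) : P set0 ->
  (forall (B : {set T}) j, j \notin B -> P B -> P (j |: B)) -> forall B, P B.
Proof.
move=> P0 PS B; have [m] := ubnP #|B|; elim: m B => // m IH B.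
have [->//|[j jB]] := set_0Vmem B.
rewrite (cardsD1 j) jB -[in P B](setD1K jB) ltnS => ltBm.
by apply: PS; rewrite ?setD11 //; apply: IH.
Qed.

Section Submodular.
Variables (R : realFieldType) (T : finType) (g : {set T} -> R).

(** This is submodularity, in its one-element form. *)
Definition diminishing := forall (S S' : {set T}) (j : T),
  S \subset S' -> j \notin S' -> g (j |: S') - g S' <= g (j |: S) - g S.

Definition increasing := forall (S : {set T}) (j : T), g S <= g (j |: S).

Hypotheses (g_dim : diminishing) (g_inc : increasing).

Lemma increasing_subset (S S' : {set T}) : S \subset S' -> g S <= g S'.
Proof.
move=> /setUidPr <-; elim/finset_ind: S' => [|B j _ IH]; first by rewrite setU0.
by rewrite setUCA (le_trans IH).
Qed.

(** Adding the elements of B one at a time, each gain is measured at a set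
    containing S, where it is at most the gain at S itself. *)
Lemma gain_le_sum (S B : {set T}) :
  g (S :|: B) - g S <= \sum_(j in B) (g (j |: S) - g S).
Proof.
elim/finset_ind: B => [|B j jB IH]; first by rewrite setU0 subrr big_set0.
rewrite big_setU1 //= setUCA; have [jS|jNS] := boolP (j \in S).
  have /setUidPr-> : [set j] \subset S :|: B by rewrite sub1set inE jS.
  by rewrite (le_trans IH) // lerDr subr_ge0.
have := g_dim (subsetUl S B) (j := j); rewrite inE negb_or jNS jB => /(_ isT).
move: IH; set s := \sum_(_ in _) _; lra.
Qed.

(** Building S up from the empty set, each element is gained at a set contained
    in S minus that element, so it contributes at least what its removal from
    S would cost. *)
Lemma sum_loss_le (S : {set T}) :
  \sum_(i in S) (g S - g (S :\ i)) <= g S - g set0.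
Proof.
suff H (B : {set T}) : B \subset S ->
    \sum_(i in B) (g S - g (S :\ i)) <= g B - g set0.
  exact: H.
elim/finset_ind: B => [|B i iB IH]; first by rewrite big_set0 subrr.
rewrite subUset sub1set => /andP[iS BS]; rewrite big_setU1 //=.
have := g_dim (S := B) (S' := S :\ i) (j := i).
rewrite subsetD1 BS iB setD11 setD1K // => /(_ isT isT).
move: (IH BS); set s := \sum_(_ in _) _; lra.
Qed.

(** The bound of Nemhauser, Wolsey and Fisher for the interchange heuristic.
    Starting the comparison from S minus one element, rather than from S,
    leaves k - 1 excess terms instead of k: this is what improves the
    factor 2 to (2 k - 1) / k. *)
Theorem swap_optimum_bound (S Sopt : {set T}) :
  g set0 = 0 -> #|Sopt| = #|S| ->
  (forall i j, i \in S -> j \notin S -> g (j |: (S :\ i)) <= g S) ->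
  #|S|%:R * g Sopt <= (2 * #|S|%:R - 1) * g S.
Proof.
move=> g0 cardS opt; set k : R := #|S|%:R.
have one i : i \in S -> g Sopt <= g S + (k - 1) * (g S - g (S :\ i)).
  move=> iS; have := increasing_subset (subsetUr (S :\ i) Sopt).
  have := gain_le_sum (S :\ i) Sopt.
  have : \sum_(j in Sopt) (g (j |: S :\ i) - g (S :\ i)) <=
         \sum_(j in Sopt) (g S - g (S :\ i)).
    (* For j in S the enlarged set stays inside S, so monotonicity suffices. *)
    apply: ler_sum => j _; rewrite lerD2r; have [jS|] := boolP (j \in S).
      by apply: increasing_subset; rewrite subUset sub1set jS subD1set.
    exact: opt.
  rewrite sumr_const cardS -mulr_natl -/k.
  set s := \sum_(_ in _) _; lra.
have : \sum_(i in S) g Sopt <=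
       \sum_(i in S) (g S + (k - 1) * (g S - g (S :\ i))) by exact: ler_sum.
rewrite big_split /= -mulr_sumr !sumr_const.
rewrite -[g Sopt *+ _]mulr_natl -[g S *+ _]mulr_natl -/k.
have := sum_loss_le S; rewrite g0 subr0; set s := \sum_(_ in _) _ => le_s.
have [k0|] := posnP #|S|.
  have -> : s = 0 by rewrite /s (cards0_eq k0) big_set0.
  by move: (g0); rewrite -(cards0_eq k0) => ->; rewrite !mulr0 !addr0.
rewrite -(ler_nat R) -/k => k1.
have : (k - 1) * s <= (k - 1) * g S by rewrite ler_wpM2l // subr_ge0.
lra.
Qed.

End Submodular.

(** * Principal minors as determinants of a fixed size *)

(** Completing A[S] by the identity keeps the determinant and fixes the index
    type, so that minors for different S are compared without renumbering. *)
Definition padmx (R : pzRingType) n (A : 'M[R]_n) (S : {set 'I_n}) : 'M[R]_n :=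
  \matrix_(i, j) if (i \in S) && (j \in S) then A i j else (i == j)%:R.

Lemma det_reindex (R : comPzRingType) m n (f : 'I_m -> 'I_n) (A : 'M[R]_n) :
  m = n -> injective f -> \det (mxsub f f A) = \det A.
Proof.
move=> mn; case: n / mn f A => f A f_inj.
have -> : mxsub f f A = row_perm (perm f_inj) (col_perm (perm f_inj) A).
  by apply/matrixP=> i j; rewrite !mxE !permE.
rewrite row_permE col_permE !det_mulmx !det_perm odd_permV mulrC -mulrA.
by rewrite -signr_addb addbb mulr1.
Qed.

(** Listing S first and its complement second turns the padded matrix into the
    block diagonal matrix with blocks A[S] and 1. *)
Lemma det_prinsub (R : realType) n (A : 'M[R]_n) (S : {set 'I_n}) :
  \det (prinsub A S) = \det (padmx A S).
Proof.
pose f (x : 'I_(#|S| + #|~: S|)) : 'I_n :=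
  match split x with inl i => enum_val i | inr i => enum_val i end.
have f_inj : injective f.
  move=> x y; rewrite -{2}[x]splitK -{2}[y]splitK /f.
  case: (split x) => a; case: (split y) => b.
  - by move/enum_val_inj->.
  - by move=> ab; move: (enum_valP b); rewrite -ab inE enum_valP.
  - by move=> ab; move: (enum_valP a); rewrite ab inE enum_valP.
  - by move/enum_val_inj->.
have szE : (#|S| + #|~: S| = n)%N by rewrite cardsC card_ord.
rewrite -(det_reindex (padmx A S) szE f_inj).
have -> : mxsub f f (padmx A S) = block_mx (prinsub A S) 0 0 1%:M.
  apply/matrixP=> x y; rewrite -[x]splitK -[y]splitK.
  have inS (a : 'I_#|S|) : enum_val a \in S by exact: enum_valP.
  have outS (a : 'I_#|~: S|) : enum_val a \in S = false.
    by apply/negbTE; rewrite -in_setC enum_valP.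
  have fl a : f (lshift _ a) = enum_val a.
    by rewrite /f -[lshift _ a]/(unsplit (inl a)) unsplitK.
  have fr a : f (rshift _ a) = enum_val a.
    by rewrite /f -[rshift _ a]/(unsplit (inr a)) unsplitK.
  case: (split x) => a; case: (split y) => b /=;
    rewrite ?(block_mxEul, block_mxEur, block_mxEdl, block_mxEdr) mxE ?fl ?fr;
    rewrite !mxE ?inS ?outS //=.
  - by case: eqP => // ab; move: (inS a); rewrite ab outS.
  - by case: eqP => // ab; move: (inS b); rewrite -ab outS.
  - by rewrite (inj_eq enum_val_inj).
by rewrite det_ublock det1 mulr1.
Qed.

Lemma padmx_row_out (R : comPzRingType) n (A : 'M[R]_n) (S : {set 'I_n}) i
    (x : 'cV[R]_n) :
  i \notin S -> (padmx A S *m x) i 0 = x i 0.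
Proof.
move=> iS; rewrite mxE (bigD1 i) //= big1 ?addr0 => [|l il].
  by rewrite mxE (negbTE iS) eqxx mul1r.
by rewrite mxE (negbTE iS) eq_sym (negbTE il) mul0r.
Qed.

Lemma padmx_row_in (R : comPzRingType) n (A : 'M[R]_n) (S : {set 'I_n}) i
    (x : 'cV[R]_n) :
  i \in S -> (forall l, l \notin S -> x l 0 = 0) ->
  (padmx A S *m x) i 0 = (A *m x) i 0.
Proof.
move=> iS x0; rewrite !mxE; apply: eq_bigr => l _; rewrite mxE iS /=.
by case: ifPn => // /x0->; rewrite !mulr0.
Qed.

(** Row j of [padmx A S] is the j-th unit vector, and [padmx A S] and
    [padmx A (j |: S)] agree once row and column j are deleted. *)
Lemma cofactor_padmx (R : comPzRingType) n (A : 'M[R]_n) (S : {set 'I_n}) j :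
  j \notin S -> cofactor (padmx A (j |: S)) j j = \det (padmx A S).
Proof.
move=> jS; rewrite (expand_det_row _ j) (bigD1 j) //= big1 ?addr0 => [|l lj].
  rewrite mxE (negbTE jS) eqxx mul1r /cofactor; congr (_ * \det _).
  apply/matrixP=> a b; rewrite !mxE !inE.
  by rewrite ![lift j _ == j]eq_sym !(negbTE (neq_lift _ _)).
by rewrite mxE (negbTE jS) eq_sym (negbTE lj) mul0r.
Qed.

Lemma det_padmx0 (R : comPzRingType) n (A : 'M[R]_n) :
  \det (padmx A set0) = 1.
Proof.
by rewrite -[RHS](det1 R n); congr (\det _); apply/matrixP=> i j; rewrite !mxE inE.
Qed.

(** * The ratio of nested minors as a constrained minimum *)

Section Schur.
Variables (R : realType) (n : nat) (A : 'M[R]_n).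
Hypothesis A_pd : pdmx A.
Implicit Types (S : {set 'I_n}) (x y : 'cV[R]_n).
Local Notation D S := (\det (padmx A S)).
Local Notation qf x := ((x^T *m A *m x) 0 0).

Lemma pdmx_ge0 x : 0 <= qf x.
Proof.
have [->|/A_pd.2/ltW//] := eqVneq x 0; first by rewrite mulmx0 mxE.
Qed.

(** The witness is column j of the adjugate of [padmx A (j |: S)].  Up to scaling
    it is the minimizer of the quadratic form, and the conditions on A w are
    the first-order conditions.  The adjugate, unlike the inverse, is available
    before the minors are known to be nonzero. *)
Lemma bordered_column S j : j \notin S -> exists w : 'cV[R]_n,
  [/\ w j 0 = D S, forall a, a \notin j |: S -> w a 0 = 0,
      forall a, a \in S -> (A *m w) a 0 = 0 & (A *m w) j 0 = D (j |: S)].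
Proof.
move=> jS; exists (col j (\adj (padmx A (j |: S)))).
set w := col _ _.
have Mw : padmx A (j |: S) *m w = D (j |: S) *: delta_mx j 0.
  rewrite /w colE mulmxA mul_mx_adj.
  by rewrite -[_%:M]scalemx1 -scalemxAl mul1mx.
have w0 a : a \notin j |: S -> w a 0 = 0.
  move=> aS; rewrite -(padmx_row_out A w aS) Mw !mxE.
  by move: aS; rewrite !inE negb_or => /andP[/negbTE-> _]; rewrite mulr0.
have Aw a : a \in j |: S -> (A *m w) a 0 = (a == j)%:R * D (j |: S).
  by move=> aS; rewrite -(padmx_row_in A aS w0) Mw !mxE eqxx andbT mulrC.
split=> // [|a aS|].
- by rewrite /w !mxE cofactor_padmx.
- rewrite Aw ?inE ?aS ?orbT //; case: eqP => [aj|_]; rewrite ?mul0r //.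
  by move: jS; rewrite -aj aS.
- by rewrite Aw ?setU11 // eqxx mul1r.
Qed.

Lemma qf_bordered x y j S : (forall a, a \notin j |: S -> x a 0 = 0) ->
  (forall a, a \in S -> (A *m y) a 0 = 0) ->
  (x^T *m A *m y) 0 0 = x j 0 * (A *m y) j 0.
Proof.
move=> x0 y0; rewrite -mulmxA mxE (bigD1 j) //= big1 ?addr0 => [|a aj].
  by rewrite mxE.
rewrite mxE; have [aS|aS] := boolP (a \in S); first by rewrite y0 ?mulr0.
by rewrite x0 ?mul0r // !inE negb_or aj.
Qed.

(** Induction on S: for the vector w of [bordered_column], w^T A w is the product
    of two consecutive minors. *)
Lemma det_padmx_gt0 S : 0 < D S.
Proof.
elim/finset_ind: S => [|S j jS D_gt0]; first by rewrite det_padmx0.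
have [w [wj w0 wS wD]] := bordered_column jS.
have := A_pd.2 w; rewrite (qf_bordered w0 wS) wj wD pmulr_rgt0 //; apply.
by apply: contraTneq D_gt0 => w_eq0; rewrite -wj w_eq0 mxE ltxx.
Qed.

(** A feasible y differs from the critical point y0 by a vector z supported on S,
    where A y0 vanishes; the cross terms disappear and the excess is z^T A z. *)
Lemma schur_minimum S j : j \notin S -> exists y0 : 'cV[R]_n,
  [/\ y0 j 0 = 1, forall a, a \notin j |: S -> y0 a 0 = 0,
      qf y0 = D (j |: S) / D S
    & forall y, y j 0 = 1 -> (forall a, a \notin j |: S -> y a 0 = 0) ->
        qf y0 <= qf y].
Proof.
move=> jS; have [w [wj w0 wS wD]] := bordered_column jS.
have DS := det_padmx_gt0 S; pose y0 := (D S)^-1 *: w.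
have y0S a : a \in S -> (A *m y0) a 0 = 0.
  by move=> aS; rewrite -scalemxAr mxE wS ?mulr0.
have y0j : y0 j 0 = 1 by rewrite mxE wj mulVf ?gt_eqF.
have y00 a : a \notin j |: S -> y0 a 0 = 0 by move=> /w0 wa; rewrite mxE wa mulr0.
exists y0; split=> //.
  by rewrite (qf_bordered y00 y0S) y0j mul1r -scalemxAr mxE wD mulrC.
clearbody y0; move=> y yj yS; set z := y - y0.
have zE a : z a 0 = y a 0 - y0 a 0 by rewrite !mxE.
have zj : z j 0 = 0 by rewrite zE yj y0j subrr.
have z0 a : a \notin j |: S -> z a 0 = 0.
  by move=> aS; rewrite zE yS // y00 // subrr.
have zy0 : (z^T *m A *m y0) 0 0 = 0 by rewrite (qf_bordered z0 y0S) zj mul0r.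
have y0z : (y0^T *m A *m z) 0 0 = 0.
  have -> : y0^T *m A *m z = (z^T *m A *m y0)^T.
    by rewrite !trmx_mul trmxK A_pd.1 mulmxA.
  by rewrite mxE.
have -> : y = y0 + z by rewrite addrC subrK.
clearbody z.
have addE (M N : 'M[R]_1) : (M + N) 0 0 = M 0 0 + N 0 0 by rewrite mxE.
have -> : (y0 + z)^T = y0^T + z^T by rewrite raddfD.
rewrite !mulmxDl !mulmxDr !addE.
by rewrite zy0 y0z addr0 add0r lerDl pdmx_ge0.
Qed.

Lemma det_ratio_anti S S' j : S \subset S' -> j \notin S' ->
  D (j |: S') / D S' <= D (j |: S) / D S.
Proof.
move=> SS' jS'; have jS : j \notin S by apply: contra jS'; apply: subsetP.
have [y0 [y0j y0S <- _]] := schur_minimum jS.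
have [y1 [_ _ <- y1_min]] := schur_minimum jS'.
apply: y1_min => // a aS'; apply: y0S; apply: contra aS'.
exact/subsetP/setUS.
Qed.

Lemma det_ratio_ge (c : R) S j : 0 <= c ->
  (forall x, c * (x^T *m x) 0 0 <= qf x) -> j \notin S ->
  c <= D (j |: S) / D S.
Proof.
move=> c_ge0 cA jS; have [y [yj _ <- _]] := schur_minimum jS.
apply: le_trans (cA y); rewrite -[leLHS]mulr1 ler_wpM2l // mxE (bigD1 j) //=.
by rewrite mxE yj mulr1 lerDl sumr_ge0 // => a _; rewrite mxE -expr2 sqr_ge0.
Qed.

End Schur.

(** * The smallest eigenvalue *)

Lemma perm_eigenvalues (R : realType) n (A : 'M[R]_n) (s : seq R) :
  char_poly A = \prod_(x <- s) ('X - x%:P) -> perm_eq (eigenvalues A) s.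
Proof.
move=> chA; rewrite /eigenvalues chA perm_sort; apply/allP=> /= z _; apply/eqP.
rewrite -[RHS]mu_prod_XsubC; set p := \prod_(_ <- _) _.
have p0 : p != 0 by rewrite monic_neq0 // monic_prod_XsubC.
rewrite count_flatten -map_comp sumnE big_map.
have rootsE x : (x \in rootsR p) = root p x.
  by rewrite -roots_on_rootsR // in_itv.
under eq_bigr do rewrite /= count_nseq /=.
have [zr|zr] := boolP (z \in rootsR p).
  rewrite (bigD1_seq z) ?uniq_roots //= eqxx mul1n big1 ?addn0 // => i iz.
  by rewrite (negbTE iz).
rewrite mupNroot -?rootsE // big_seq big1 // => i ir.
by have [iz|//] := eqVneq i z; rewrite -iz ir in zr.
Qed.

(** A complete factorization of the characteristic polynomial guarantees that
    the list of real eigenvalues has n entries, so that its entry of index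
    n - 1 is a genuine eigenvalue and not the default value of [nth]. *)
Lemma eigval_last (R : realType) n (A : 'M[R]_n) (s : seq R) :
  (0 < n)%N -> char_poly A = \prod_(x <- s) ('X - x%:P) ->
  eigval A n \in s /\ forall x, x \in s -> eigval A n <= x.
Proof.
move=> n_gt0 chA; have sE := perm_eigenvalues chA.
have sz : size (eigenvalues A) = n.
  rewrite (perm_size sE); have /eqP := size_char_poly A.
  by rewrite chA size_prod_XsubC eqSS => /eqP.
split=> [|x]; first by rewrite -(perm_mem sE) mem_nth // sz prednK.
rewrite -(perm_mem sE) => /(nthP 0)[m]; rewrite sz => ltmn <-.
have := @sorted_leq_nth _ (>=%R : rel R) ge_trans ge_refl 0 (eigenvalues A).
rewrite sort_sorted; last by move=> a b; rewrite /= orbC le_total.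
by move=> /(_ isT m n.-1); rewrite !inE sz ltn_predL; apply=> //; rewrite -ltnS prednK.
Qed.

Section Spectral.
Local Open Scope sesquilinear_scope.

Lemma char_poly_conj (F : comNzRingType) n (P Q D : 'M[F]_n) :
  Q *m P = 1%:M -> char_poly (Q *m D *m P) = char_poly D.
Proof.
move=> QP1; pose f := map_mx (@polyC F).
have -> : char_poly (Q *m D *m P) = \det (f n n Q *m char_poly_mx D *m f n n P).
  congr (\det _); rewrite /char_poly_mx !map_mxM mulmxBr mulmxBl -!mulmxA.
  by rewrite mul_scalar_mx -scalemxAr -(map_mxM _ Q P) QP1 map_mx1 scalemx1.
rewrite !det_mulmx mulrAC -det_mulmx -map_mxM QP1 map_mx1 det1 mul1r //.
Qed.

(** A real symmetric matrix is Hermitian over R[i], where it is unitarily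
    diagonalizable with real diagonal.  The diagonalizing matrix P may be
    left complex: only the moduli of the entries of P x matter below. *)
Lemma symmetric_diagonalization (R : rcfType) n (A : 'M[R]_n) : A^T = A ->
  exists (d : 'rV[R]_n) (P : 'M[complex R]_n),
    [/\ char_poly A = \prod_(x <- [seq d 0 i | i : 'I_n]) ('X - x%:P),
        P^t* *m P = 1%:M
      & map_mx (real_complex R) A =
          P^t* *m diag_mx (map_mx (real_complex R) d) *m P].
Proof.
move=> A_sym; pose B := map_mx (real_complex R) A.
have B_herm : B \is hermsymmx.
  apply: realsym_hermsym.
    by apply/is_hermitianmxP; rewrite scale1r map_mx_id // map_trmx A_sym.
  by apply/mxOverP => i j; rewrite mxE; apply/complex_realP; exists (A i j).
have B_diag := orthomx_spectralP (hermitian_normalmx B_herm).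
have P_unitary := spectral_unitarymx B.
have P_unit := spectral_unit B.
set P := spectralmx B in B_diag P_unitary P_unit.
pose d := map_mx (@complex.Re R) (spectral_diag B).
have dE : spectral_diag B = map_mx (real_complex R) d.
  apply/rowP=> j; rewrite !mxE; apply/esym/RRe_real.
  exact: mxOverP (hermitian_spectral_diag_real B_herm) _ _.
rewrite dE in B_diag; exists d, P.
have PP : P^t* *m P = 1%:M by rewrite -invmx_unitary // mulVmx.
rewrite invmx_unitary // in B_diag; split => //.
apply: (map_poly_inj (real_complex R)).
rewrite map_char_poly -/B B_diag char_poly_conj //.
rewrite char_poly_trig ?diag_mx_is_trig // rmorph_prod big_map big_enum /=.
apply: eq_bigr => i _; rewrite map_polyXsubC !mxE eqxx mulr1n //.
Qed.

(** With w = P x, one has x^T x = sum |w_i|^2 and x^T A x = sum d_i |w_i|^2. *)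
Lemma rayleigh_lower_bound (R : rcfType) n (A : 'M[R]_n) : A^T = A ->
  exists s : seq R, char_poly A = \prod_(x <- s) ('X - x%:P) /\
    forall c, (forall x, x \in s -> c <= x) ->
    forall x : 'cV[R]_n, c * (x^T *m x) 0 0 <= (x^T *m A *m x) 0 0.
Proof.
move=> /symmetric_diagonalization[d [P [chA PP AE]]].
exists [seq d 0 i | i : 'I_n]; split=> // c c_le x.
pose rc := real_complex R; pose xC := map_mx rc x.
have xCt : map_mx rc x^T = xC^t*.
  apply/matrixP=> i j; rewrite !mxE; apply/esym/CrealP.
  by apply/complex_realP; exists (x j i).
rewrite -lecR rmorphM /=.
have toC (M : 'M[R]_1) : real_complex R (M 0 0) = (map_mx rc M) 0 0 by rewrite mxE.
pose w := P *m xC.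
have wt : w^t* = xC^t* *m P^t* by rewrite trmx_mul map_mxM.
have -> : real_complex R ((x^T *m x) 0 0) = \sum_i `|w i 0| ^+ 2.
  rewrite toC map_mxM xCt -/xC.
  have -> : xC^t* *m xC = w^t* *m w by rewrite wt -mulmxA /w (mulmxA (P^t*)) PP mul1mx.
  rewrite mxE; apply: eq_bigr => i _; rewrite !mxE.
  by rewrite normCK mulrC.
have -> : real_complex R ((x^T *m A *m x) 0 0) = \sum_i rc (d 0 i) * `|w i 0| ^+ 2.
  rewrite toC !map_mxM xCt -/xC AE !mulmxA -wt -mulmxA -/w.
  rewrite -mulmxA mxE; apply: eq_bigr => i _; rewrite mul_diag_mx !mxE.
  by rewrite normCK mulrC -mulrA.
rewrite mulr_sumr; apply: ler_sum => i _; rewrite ler_wpM2r ?exprn_ge0 //.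
by rewrite lecR c_le // map_f // mem_enum.
Qed.

End Spectral.

(** Positivity of the eigenvalue is that of the form at an eigenvector. *)
Lemma eigval_min_pd (R : realType) n (A : 'M[R]_n) : pdmx A -> (0 < n)%N ->
  0 < eigval A n /\
  forall x : 'cV[R]_n, eigval A n * (x^T *m x) 0 0 <= (x^T *m A *m x) 0 0.
Proof.
move=> [A_sym A_pos] n_gt0; have [s [chA ray]] := rayleigh_lower_bound A_sym.
have [ls min_s] := eigval_last n_gt0 chA; split; last exact: ray.
have : eigenvalue A (eigval A n).
  by rewrite eigenvalue_root_char chA root_prod_XsubC.
move=> /eigenvalueP[v vA v0].
have := A_pos v^T; rewrite trmxK vA -scalemxAl mxE -trmx_eq0 trmxK => /(_ v0).
rewrite pmulr_lgt0 // lt0r; apply/andP; split.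
  apply: contraTneq v0; rewrite mxE => /eqP; rewrite psumr_eq0 => [|i _].
    move=> /allP vz; rewrite negbK; apply/eqP/rowP=> i; rewrite mxE.
    by have := vz i (mem_index_enum _); rewrite mxE mulf_eq0 orbb => /eqP.
  by rewrite mxE -expr2 sqr_ge0.
by rewrite mxE sumr_ge0 // => i _; rewrite mxE -expr2 sqr_ge0.
Qed.

(** * The scaled log-determinant *)

(** This is ln det (A/c)[S], for A positive definite and c > 0. *)
Definition scaled_logdet (R : realType) n (A : 'M[R]_n) (c : R) (S : {set 'I_n}) : R :=
  ln (\det (padmx A S)) - #|S|%:R * ln c.

Lemma scaled_logdetU1 (R : realType) n (A : 'M[R]_n) c (S : {set 'I_n}) j :
  pdmx A -> j \notin S ->
  scaled_logdet A c (j |: S) - scaled_logdet A c S =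
    ln (\det (padmx A (j |: S)) / \det (padmx A S)) - ln c.
Proof.
move=> A_pd jS; have D_gt0 := det_padmx_gt0 A_pd.
rewrite ln_div ?posrE // /scaled_logdet cardsU1 jS natrD mulrDl mul1r.
set a := ln _; set b := ln _; set s := _ * _; lra.
Qed.

Lemma scaled_logdet_diminishing (R : realType) n (A : 'M[R]_n) c :
  pdmx A -> diminishing (scaled_logdet A c).
Proof.
move=> A_pd S S' j SS' jS'; have D_gt0 := det_padmx_gt0 A_pd.
have jS : j \notin S by apply: contra jS'; apply: subsetP.
rewrite !scaled_logdetU1 // lerD2r ler_ln ?posrE ?divr_gt0 //.
exact: det_ratio_anti.
Qed.

Lemma scaled_logdet_increasing (R : realType) n (A : 'M[R]_n) c :
  pdmx A -> 0 < c ->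
  (forall x : 'cV[R]_n, c * (x^T *m x) 0 0 <= (x^T *m A *m x) 0 0) ->
  increasing (scaled_logdet A c).
Proof.
move=> A_pd c_gt0 cA S j; have D_gt0 := det_padmx_gt0 A_pd.
have [jS|jS] := boolP (j \in S).
  by rewrite (setUidPr _) // sub1set.
rewrite -subr_ge0 scaled_logdetU1 // subr_ge0 ler_ln ?posrE ?divr_gt0 //.
by apply: det_ratio_ge; rewrite // ltW.
Qed.

Lemma logvol_prinsub (R : realType) n (A : 'M[R]_n) (S : {set 'I_n}) : pdmx A ->
  logvol (prinsub A S) = ln (\det (padmx A S)).
Proof.
by move=> A_pd; rewrite /logvol /vol det_prinsub gtr0_norm ?det_padmx_gt0.
Qed.

Lemma logvol_scale_prinsub (R : realType) n (A : 'M[R]_n) c (S : {set 'I_n}) : pdmx A ->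
  0 < c -> logvol (c^-1 *: prinsub A S) = scaled_logdet A c S.
Proof.
move=> A_pd c_gt0; have D_gt0 := det_padmx_gt0 A_pd S.
rewrite /logvol /vol detZ det_prinsub gtr0_norm ?mulr_gt0 ?exprn_gt0 ?invr_gt0 //.
rewrite lnM ?posrE ?exprn_gt0 ?invr_gt0 // lnXn ?invr_gt0 // lnV ?posrE //.
by rewrite /scaled_logdet addrC mulNrn mulr_natl.
Qed.

Lemma vol_prinsub_gt0 (R : realType) n (A : 'M[R]_n) (S : {set 'I_n}) : pdmx A ->
  0 < vol (prinsub A S).
Proof.
by move=> A_pd; rewrite /vol det_prinsub normr_gt0 gt_eqF ?det_padmx_gt0.
Qed.

Lemma pdmx_unit (R : realType) n (A : 'M[R]_n) : pdmx A -> A \in unitmx.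
Proof.
move=> A_pd; rewrite unitmxE unitfE gt_eqF //.
have -> : A = padmx A setT by apply/matrixP=> i j; rewrite mxE !inE.
exact: det_padmx_gt0.
Qed.

(** * The selection algorithm *)

Lemma card_swap n (S : {set 'I_n}) i j : i \in S -> j \notin S ->
  #|swap S i j| = #|S|.
Proof.
by move=> iS jS; rewrite cardsU1 !inE (negbTE jS) andbF [in RHS](cardsD1 i) iS.
Qed.

Lemma srr_cholesky_step (R : realType) n (A : 'M[R]_n) k (S T : {set 'I_n}) : pdmx A ->
  step (srr_cholesky A k 1) S T <->
  step (interchange1 (fun S => logvol (prinsub A S)) k) S T.
Proof.
move=> A_pd; have V_gt0 U := vol_prinsub_gt0 U A_pd.
split=> -[i [j [iS jS -> lt_vol]]]; exists i, j; split=> //; move: lt_vol;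
  by rewrite sqrtr1 mul1r /logvol ltr_ln ?posrE.
Qed.

Lemma srr_cholesky_start (R : realType) n (A : 'M[R]_n) k (S : {set 'I_n}) : pdmx A ->
  (0 < k < n)%N -> start (srr_cholesky A k 1) S <-> #|S| = k.
Proof.
move=> A_pd /andP[k_gt0 k_lt_n]; split=> [[]|cS] //; split=> //.
- by split=> [|x]; [exact: A_pd.1 | exact: pdmx_ge0].
- by rewrite k_gt0 mxrank_unit ?pdmx_unit // ltnW.
- by rewrite unitmxE unitfE det_prinsub gt_eqF ?det_padmx_gt0.
Qed.

Lemma srr_cholesky_card (R : realType) n (A : 'M[R]_n) k eta (S : {set 'I_n}) :
  output (srr_cholesky A k eta) S -> #|S| = k.
Proof.
move=> [S0 [[_ _ _ <- _] run _]].
elim: run => {S0 S} [S T [i [j [iS jS -> _]]]|//|S T U _ <- _ <-//].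
exact: card_swap.
Qed.

Theorem corollary6p5 (R : realType) (n k : nat) (A : 'M[R]_n)
    (Sopt : {set 'I_n}) :
  pdmx A -> (0 < k < n)%N -> max_logvol A k Sopt ->
  [/\ is_interchange1 (srr_cholesky A k 1) (fun S => logvol (prinsub A S)) k,
      (forall S : {set 'I_n}, output (srr_cholesky A k 1) S ->
         0 <= logvol (prinsub A Sopt) - logvol (prinsub A S)
           <= (k%:R - 1) / (2 * k%:R - 1)
              * logvol ((eigval A n)^-1 *: prinsub A Sopt))
    & (k%:R - 1) / (2 * k%:R - 1) < 1 / 2 :> R].
Proof.
move=> A_pd kn [cardSopt maxSopt]; have [k_gt0 k_lt_n] := andP kn.
have k_ge1 : 1 <= k%:R :> R by rewrite ler1n.
have den_gt0 : 0 < 2 * k%:R - 1 :> R by lra.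
split.
- by split=> [S|S T _]; [exact: srr_cholesky_start | exact: srr_cholesky_step].
- move=> S outS; have cardS := srr_cholesky_card outS.
  rewrite subr_ge0 maxSopt //=.
  have [l_gt0 ray] := eigval_min_pd A_pd (ltn_trans k_gt0 k_lt_n).
  set l := eigval A n in l_gt0 ray *; pose g := scaled_logdet A l.
  have gE (U : {set 'I_n}) : #|U| = k -> g U = logvol (prinsub A U) - k%:R * ln l.
    by move=> cU; rewrite logvol_prinsub // /g /scaled_logdet cU.
  have opt i j : i \in S -> j \notin S -> g (j |: (S :\ i)) <= g S.
    move=> iS jS; rewrite !gE ?card_swap // lerD2r leNgt; apply/negP=> lt_ST.
    have [S0 [_ _ /(_ (swap S i j))]] := outS; apply.
    by apply/srr_cholesky_step => //; exists i, j.
  have g0 : g set0 = 0.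
    by rewrite /g /scaled_logdet det_padmx0 ln1 cards0 mul0r subrr.
  have : k%:R * g Sopt <= (2 * k%:R - 1) * g S.
    rewrite -cardS; apply: swap_optimum_bound => //; last by rewrite cardS.
      exact: scaled_logdet_diminishing.
    exact: scaled_logdet_increasing.
  rewrite logvol_scale_prinsub // -/g.
  (* Sets of equal size have the same correction term k ln l, so the gap of the
     log-volumes is g(Sopt) - g(S). *)
  rewrite mulrAC ler_pdivlMr // !gE //.
  set a := logvol _; set b := logvol _; set c := ln _; set K := k%:R; lra.
- by rewrite ltr_pdivrMr //; lra.
Qed.
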